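(* Let $G$ be a subgroup of the symmetric group $S_m$, let $U$ and $V$ be unitary spaces, let $\mathfrak{X}$ be an irreducible unitary representation of $G$ over $U$, and let $T\in\mathrm{End}(V)$. Then $$\operatorname{rank}\big(K^{\mathfrak{X}}(T)\big)=\operatorname{rank}(T)\cdot|\hat{\mathcal{D}}|.$$
   Context: A unitary space is a finite-dimensional complex vector space equipped with an inner product. A unitary representation of $G$ over $U$ is a group homomorphism from $G$ to the unitary operators on $U$; its character is $\chi(\sigma)=\operatorname{tr}\mathfrak{X}(\sigma)$. $\times^{m}V$ is the Cartesian product of $m$ copies of $V$. For $\sigma\in G$, $Q(\sigma)(v_1,\dots,v_m)=(v_{\sigma^{-1}(1)},\dots,v_{\sigma^{-1}(m)})$ on $\times^m V$, and $C_{\mathfrak{X}}=\frac{1}{|G|}\sum_{\sigma\in G}\mathfrak{X}(\sigma)\otimes Q(\sigma)$. The generalized Cartesian symmetry class is the range $V^{\mathfrak{X}}(G)=C_{\mathfrak{X}}(U\otimes\times^m V)$. For $T\in\mathrm{End}(V)$, $(\times^mT)(v_1,\dots,v_m)=(Tv_1,\dots,Tv_m)$; the operator $I\otimes\times^mT$ commutes with $C_{\mathfrak{X}}$, so it leaves $V^{\mathfrak{X}}(G)$ invariant, and its restriction to $V^{\mathfrak{X}}(G)$ is denoted $K^{\mathfrak{X}}(T)$. Definition of $\hat{\mathcal{D}}$: fix orthonormal bases $\{u_1,\dots,u_r\}$ of $U$ and $\{e_1,\dots,e_n\}$ of $V$, and let $e_{ij}=(\delta_{1j}e_i,\dots,\delta_{mj}e_i)\in\times^mV$.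 Let $G_j$ be the stabilizer of $j$ in $G$, $T_j=\frac{1}{|G_j|}\sum_{\sigma\in G_j}\mathfrak{X}(\sigma)$, $\Omega=\{1\le j\le m:T_j\ne0\}$, $\mathcal{D}$ a set of representatives of the orbits of $G$ on $\{1,\dots,m\}$, and $\bar{\mathcal{D}}=\mathcal{D}\cap\Omega$. Let $V^{\mathfrak{X}}_{ij}(G)=\operatorname{span}\{C_{\mathfrak{X}}(u_k\otimes e_{ij}):1\le k\le r\}$, which also equals $\operatorname{span}\{C_{\mathfrak{X}}(u_1\otimes e_{i\sigma(j)}):\sigma\in G\}$. For each $j\in\bar{\mathcal{D}}$ let $s_j=\dim V^{\mathfrak{X}}_{ij}(G)$ (which does not depend on $i$ and equals $[\chi,1_{G_j}]=\frac{1}{|G_j|}\sum_{\sigma\in G_j}\chi(\sigma)$), and choose $j_1,\dots,j_{s_j}$ in the $G$-orbit of $j$ such that $\{C_{\mathfrak{X}}(u_1\otimes e_{ij_1}),\dots,C_{\mathfrak{X}}(u_1\otimes e_{ij_{s_j}})\}$ is a basis of $V^{\mathfrak{X}}_{ij}(G)$ for every $i$. Then $\hat{\mathcal{D}}=\bigcup_{j\in\bar{\mathcal{D}}}\{j_1,\dots,j_{s_j}\}$; in particular $|\hat{\mathcal{D}}|=\sum_{j\in\bar{\mathcal{D}}}[\chi,1_{G_j}]$. *)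

(* Defs.v *)
From HB Require Import structures.
From mathcomp Require Import all_boot all_order all_algebra all_fingroup.
From mathcomp Require Import complex reals.

Set Implicit Arguments.
Unset Strict Implicit.
Unset Printing Implicit Defensive.

Import GroupScope GRing.Theory Num.Theory Num.Def.
Local Open Scope ring_scope.

(* The tensor product of two finite-dimensional spaces, modelled by matrices of
   coordinates in chosen bases of the two factors.  [tlift_tens] and
   [tlift_unique] are its universal property; [tmap f g] is the operator usually
   written f (x) g, see [tmap_tens]. *)
Section Tensor.
Variable F : fieldType.

Definition tensor (U W : vectType F) : vectType F :=
  'M[F]_(\dim {:U}, \dim {:W}).

Definition tens (U W : vectType F) (u : U) (w : W) : tensor U W :=
  \matrix_(i, j) (coord (vbasis {:U}) i u * coord (vbasis {:W}) j w).

Definition tlift (U W Z : vectType F) (B : U -> W -> Z) (t : tensor U W) : Z :=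
  \sum_i \sum_j (t : 'M_(_, _)) i j *: B (vbasis {:U})`_i (vbasis {:W})`_j.

Definition tmap (U W U' W' : vectType F) (f : 'Hom(U, U')) (g : 'Hom(W, W')) :
    'Hom(tensor U W, tensor U' W') :=
  linfun (tlift (fun u w => tens (f u) (g w))).

Lemma linfun_linearE (A B : vectType F) (f : A -> B) :
  linear f -> linfun f =1 f.
Proof.
move=> lf.
pose lin := GRing.isLinear.Build F A B _ f lf.
pose g : {linear A -> B} := HB.pack f lin.
exact: (lfunE g).
Qed.

Section Theory.
Variables U W Z : vectType F.

Fact tens_linearl (w : W) : linear (fun u : U => tens u w).
Proof.
by move=> a u v; apply/matrixP => i j; rewrite !mxE linearP mulrDl mulrA.
Qed.

Fact tens_linearr (u : U) : linear (fun w : W => tens u w).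
Proof.
by move=> a v w; apply/matrixP => i j; rewrite !mxE linearP mulrDr mulrCA.
Qed.

Fact tlift_linear (B : U -> W -> Z) : linear (tlift B).
Proof.
move=> a s t; rewrite /tlift scaler_sumr -big_split; apply: eq_bigr => i _ /=.
rewrite scaler_sumr -big_split; apply: eq_bigr => j _ /=.
by rewrite !mxE scalerDl scalerA.
Qed.
HB.instance Definition _ (B : U -> W -> Z) :=
  GRing.isLinear.Build F (tensor U W) Z _ (tlift B) (tlift_linear B).

Lemma linear_sum_coord (T : vectType F) (f : T -> Z) : linear f ->
  forall x, f x = \sum_i coord (vbasis {:T}) i x *: f (vbasis {:T})`_i.
Proof.
move=> lf x.
pose lin := GRing.isLinear.Build F T Z _ f lf.
pose g : {linear T -> Z} := HB.pack f lin.
rewrite [in LHS](coord_vbasis (memvf x)) -[f]/(g : T -> Z).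
by rewrite !linear_sum; apply: eq_bigr => i _; rewrite !linearZ.
Qed.

Lemma tlift_tens (B : U -> W -> Z) :
  (forall w, linear (B^~ w)) -> (forall u, linear (B u)) ->
  forall u w, tlift B (tens u w) = B u w.
Proof.
move=> Bl Br u w; rewrite (linear_sum_coord (Bl w)); apply: eq_bigr => i _.
rewrite (linear_sum_coord (Br _)) scaler_sumr; apply: eq_bigr => j _.
by rewrite mxE scalerA.
Qed.

Lemma tlift_unique (B : U -> W -> Z) (g : {linear tensor U W -> Z}) :
  (forall u w, g (tens u w) = B u w) -> g =1 tlift B.
Proof.
move=> gB t; rewrite [t in LHS](matrix_sum_delta (t : 'M_(_, _))) linear_sum.
apply: eq_bigr => i _; rewrite linear_sum; apply: eq_bigr => j _.
rewrite linearZ /= -gB; congr (_ *: g _); apply/matrixP => k l.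
rewrite !mxE !coord_free ?(basis_free (vbasisP _)) //.
by rewrite -natrM mulnb (eq_sym k) (eq_sym l).
Qed.

End Theory.

Lemma tmap_tens (U W U' W' : vectType F) (f : 'Hom(U, U')) (g : 'Hom(W, W'))
    u w : tmap f g (tens u w) = tens (f u) (g w).
Proof.
rewrite lfunE /= tlift_tens // => [{}w a x y | {}u a x y]; rewrite linearP.
  exact: tens_linearl.
exact: tens_linearr.
Qed.

Lemma tens_lfunP (U W Z : vectType F) (f g : 'Hom(tensor U W, Z)) :
  (forall u w, f (tens u w) = g (tens u w)) -> f = g.
Proof.
move=> fg; apply/lfunP => t.
by rewrite (tlift_unique fg) -(tlift_unique (fun u w => erefl)).
Qed.

End Tensor.

Section CartesianSymmetryClasses.
Variable C : numClosedFieldType.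

Definition lfun_rank (A B : vectType C) (f : 'Hom(A, B)) : nat := \dim (limg f).

Definition orthonormal_basis (U : vectType C) (dot : {dot U for conjC})
  (b : seq U) := basis_of fullv b && orthonormal dot b.

Section Representation.
Variables (m : nat) (G : {group 'S_m}) (U : vectType C).

(* The product [s * t] of two permutations is "[s], then [t]", that is, the
   composite t o s of the usual notation: this is why the factors are swapped.
   Only the values of [X] on [G] are relevant. *)
Definition unitary_rep (dot : {dot U for conjC}) (X : 'S_m -> 'End(U)) : Prop :=
  [/\ X 1%g = \1%VF,
      {in G &, forall s t, X (s * t)%g = (X t \o X s)%VF}
    & {in G, forall s, isometry dot dot (X s)}].

Definition irreducible_rep (X : 'S_m -> 'End(U)) : Prop :=
  (fullv : {vspace U}) <> 0%VS /\
  forall W : {vspace U}, {in G, forall s, (X s @: W <= W)%VS} ->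
    W = 0%VS \/ W = fullv.

End Representation.

Section SymmetryClass.
Variables (m : nat) (G : {group 'S_m}) (U V : vectType C).
Variable X : 'S_m -> 'End(U).

Definition cartpow : vectType C := {ffun 'I_m -> V}.

Definition cart_perm (s : 'S_m) : 'End(cartpow) :=
  linfun (fun v : cartpow => [ffun k => v ((s^-1 : 'S_m)%g k)] : cartpow).

Definition cart_map (T : 'End(V)) : 'End(cartpow) :=
  linfun (fun v : cartpow => [ffun k => T (v k)] : cartpow).

Definition cart_single (x : V) (j : 'I_m) : cartpow :=
  [ffun k => if k == j then x else 0].

Definition symmetrizer : 'End(tensor U cartpow) :=
  #|G|%:R^-1 *: \sum_(s in G) tmap (X s) (cart_perm s).

Definition symmetry_class : {vspace tensor U cartpow} := limg symmetrizer.

(* The projection [vsproj] is only there to retype the value, which is already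
   in the symmetry class, see [val_induced_op]. *)
Definition induced_op (T : 'End(V)) : 'End(subvs_of symmetry_class) :=
  linfun (fun x => vsproj symmetry_class (tmap \1 (cart_map T) (vsval x))).

Definition stab_mean (j : 'I_m) : 'End(U) :=
  #|'C_G[j | 'P]|%:R^-1 *: \sum_(s in 'C_G[j | 'P]) X s.

Definition Omega : {set 'I_m} := [set j | stab_mean j != 0].

Definition orbital_subspace r (u : r.-tuple U) (x : V) (j : 'I_m) :
    {vspace tensor U cartpow} :=
  <<[seq symmetrizer (tens (tnth u k) (cart_single x j)) | k : 'I_r]>>%VS.

(* [Dhat] is one of the sets obtained from the bases u of U and e of V by
   choosing a set D of representatives of the orbits of G, and then, for each j
   in D and Omega, a set [J j] = {j_1, ..., j_(s_j)} of elements of the orbit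
   of j.  That #|J j| = s_j follows from [basis_of] as soon as V is nonzero. *)
Definition is_Dhat r n (u : r.-tuple U) (e : n.-tuple V) (Dhat : {set 'I_m}) :
    Prop :=
  exists D : {set 'I_m}, exists J : 'I_m -> {set 'I_m},
  [/\ is_transversal D (orbit 'P G @: [set: 'I_m]) [set: 'I_m],
      {in D :&: Omega, forall j, J j \subset orbit 'P G j /\
        forall i : 'I_n,
          basis_of (orbital_subspace u (tnth e i) j)
            [seq symmetrizer (tens u`_0 (cart_single (tnth e i) k))
               | k <- enum (J j)]}
    & Dhat = \bigcup_(j in D :&: Omega) J j].

Fact cart_perm_linear s :
  linear (fun v : cartpow => [ffun k => v ((s^-1 : 'S_m)%g k)] : cartpow).
Proof. by move=> a v w; apply/ffunP => k; rewrite !ffunE. Qed.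

Fact cart_map_linear (T : 'End(V)) :
  linear (fun v : cartpow => [ffun k => T (v k)] : cartpow).
Proof. by move=> a v w; apply/ffunP => k; rewrite !ffunE linearP. Qed.

Lemma cart_permE s v k : cart_perm s v k = v ((s^-1 : 'S_m)%g k).
Proof.
by rewrite /cart_perm (linfun_linearE (cart_perm_linear s)) ffunE.
Qed.

Lemma cart_mapE T v k : cart_map T v k = T (v k).
Proof.
by rewrite /cart_map (linfun_linearE (cart_map_linear T)) ffunE.
Qed.

Lemma cart_permM s t : cart_perm (s * t)%g = (cart_perm t \o cart_perm s)%VF.
Proof.
apply/lfunP => v; apply/ffunP => k.
by rewrite lfunE /= !cart_permE invMg permM.
Qed.

Lemma cart_perm_single s x j :
  cart_perm s (cart_single x j) = cart_single x (s j).
Proof.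
by apply/ffunP => k; rewrite cart_permE !ffunE (canF_eq (permKV s)).
Qed.

Lemma symmetrizerE t : symmetrizer t =
  #|G|%:R^-1 *: \sum_(s in G) tmap (X s) (cart_perm s) t.
Proof. by rewrite /symmetrizer scale_lfunE sum_lfunE. Qed.

Lemma symmetrizer_comm T :
  (tmap \1 (cart_map T) \o symmetrizer)%VF =
  (symmetrizer \o tmap \1 (cart_map T))%VF.
Proof.
apply: tens_lfunP => u v; rewrite !comp_lfunE tmap_tens !symmetrizerE.
rewrite linearZ linear_sum; congr (_ *: _); apply: eq_bigr => s _ /=.
rewrite !tmap_tens !id_lfunE; congr tens.
by apply/ffunP => k; rewrite !(cart_permE, cart_mapE).
Qed.

Fact induced_op_linear (T : 'End(V)) :
  linear (fun x : subvs_of symmetry_class =>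
            vsproj symmetry_class (tmap \1 (cart_map T) (vsval x))).
Proof. by move=> a x y; rewrite !linearP. Qed.

Lemma val_induced_op T x :
  vsval (induced_op T x) = tmap \1 (cart_map T) (vsval x).
Proof.
rewrite /induced_op (linfun_linearE (induced_op_linear T)) vsprojK //.
have /memv_imgP[y _ ->] := valP x.
by rewrite -comp_lfunE symmetrizer_comm comp_lfunE memv_img ?memvf.
Qed.

Lemma symmetrizer_idem dot : unitary_rep G dot X ->
  (symmetrizer \o symmetrizer)%VF = symmetrizer.
Proof.
case=> _ XM _; have XQM s t : s \in G -> t \in G ->
    (tmap (X t) (cart_perm t) \o tmap (X s) (cart_perm s))%VF =
      tmap (X (s * t)%g) (cart_perm (s * t)).
  move=> sG tG; apply: tens_lfunP => u v.
  by rewrite comp_lfunE !tmap_tens XM // cart_permM !comp_lfunE.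
apply/lfunP => x; rewrite comp_lfunE symmetrizerE.
rewrite (eq_bigr (fun=> symmetrizer x)) => [|t tG].
  rewrite sumr_const -scaler_nat scalerA mulVf ?scale1r //.
  by rewrite pnatr_eq0 -lt0n cardG_gt0.
rewrite symmetrizerE linearZ linear_sum /=.
congr (_ *: _); rewrite [RHS](reindex_inj (mulIg t)).
by apply: eq_big => [s | s sG]; rewrite ?groupMr // -comp_lfunE XQM.
Qed.

End SymmetryClass.

End CartesianSymmetryClasses.

(* Main.v *)
Require Import Defs.
From mathcomp Require Import all_boot all_order all_algebra all_fingroup.
From mathcomp Require Import complex reals.

Set Implicit Arguments.
Unset Strict Implicit.
Unset Printing Implicit Defensive.

Import GRing.Theory Num.Theory Num.Def.
Local Open Scope ring_scope.

(** Write P for the symmetrizer, A for the set of indices called Dhat, d for its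
cardinal, and u_1 for the first vector of the basis of U.  The theorem holds
because the operator induced by T on the symmetry class is conjugate to the
direct sum of d copies of T.  The conjugation is the linear map

  Phi : V^d -> U (x) V^m,   v |-> P (u_1 (x) v'),

where v' is v placed at the d positions of A and extended by zero.  Since P
commutes with I (x) (T x ... x T), Phi intertwines the d-th Cartesian
power of T with that operator; what has to be seen is that Phi is a linear
isomorphism onto the symmetry class.

Injectivity ([symmetrizer_Dhat_inj]).  P commutes with every operator I (x) Q for
which Q commutes with the permutations of G.  Two such Q are used: restricting a
vector of V^m to the positions in one orbit of G, and applying one endomorphism
of V, here the projection on the line of a basis vector e_i, to all components.
Both together turn P (u_1 (x) v') = 0 into a linear relation between the vectors
P (u_1 (x) e_ik), for k in the part of A lying in one orbit; these are linearly
independent by the choice of A, so each coordinate of v vanishes.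

Surjectivity ([symmetry_class_Dhat_sub]).  The class is spanned by the vectors
P (b (x) e_ij).  As P absorbs the action of G, j may be moved to the
representative of its orbit at the cost of changing b
([symmetrizer_single_act]), and b may be replaced by its mean over the
stabilizer of j ([symmetrizer_single_mean]).  If that mean operator is zero, the
vector is zero; otherwise it lies in an orbital subspace, which by the choice of
A is spanned by values of Phi.

The rank of the Cartesian power of T is then d times that of T
([rank_cart_map]). *)

(** * Linear algebra *)

Section LinearAlgebra.
Variable F : fieldType.

Lemma free_map_sum_eq0 (W : vectType F) (I : eqType) (f : I -> W) (c : I -> F)
    (s : seq I) :
  free [seq f k | k <- s] -> \sum_(k <- s) c k *: f k = 0 ->
  {in s, forall k, c k = 0}.
Proof.
elim: s => // k s IHs; rewrite /= free_cons big_cons => /andP[fk_s frs] sum0.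
have ck0 : c k = 0.
  apply: contraNeq fk_s => ck; rewrite -[f k](scalerK ck) rpredZ //.
  rewrite -[_ *: _]opprK (addr0_eq sum0) rpredN.
  rewrite big_seq rpred_sum // => l ls.
  by rewrite rpredZ // memv_span // map_f.
move: sum0; rewrite ck0 scale0r add0r => /(IHs frs) cs0 l.
by rewrite inE => /predU1P[-> | /cs0].
Qed.

Lemma tensr_sum (U W : vectType F) (b : U) I (s : seq I) (P : pred I)
    (w : I -> W) :
  tens b (\sum_(k <- s | P k) w k) = \sum_(k <- s | P k) tens b (w k).
Proof.
rewrite -(linfun_linearE (tens_linearr b)) linear_sum.
by apply: eq_bigr => k _; rewrite /= (linfun_linearE (tens_linearr b)).
Qed.

Lemma tensl_sum (U W : vectType F) (w : W) I (s : seq I) (P : pred I)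
    (b : I -> U) :
  tens (\sum_(k <- s | P k) b k) w = \sum_(k <- s | P k) tens (b k) w.
Proof.
rewrite -(linfun_linearE (tens_linearl w)) linear_sum.
by apply: eq_bigr => k _; rewrite /= (linfun_linearE (tens_linearl w)).
Qed.

Lemma tensrZ (U W : vectType F) (b : U) a (w : W) :
  tens b (a *: w) = a *: tens b w.
Proof. by rewrite -!(linfun_linearE (tens_linearr b)) linearZ. Qed.

Lemma tenslZ (U W : vectType F) a (b : U) (w : W) :
  tens (a *: b) w = a *: tens b w.
Proof. by rewrite -!(linfun_linearE (tens_linearl w)) linearZ. Qed.

Lemma tensr0 (U W : vectType F) (b : U) : tens b (0 : W) = 0.
Proof. by rewrite -[0 in LHS](scale0r 0) tensrZ scale0r. Qed.

Lemma tensl0 (U W : vectType F) (w : W) : tens (0 : U) w = 0.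
Proof. by rewrite -[0 in LHS](scale0r 0) tenslZ scale0r. Qed.

(** Pure tensors span the tensor product. *)
Lemma limg_tens_sub (U W Z : vectType F) (f : 'Hom(tensor U W, Z))
    (A : {vspace Z}) :
  (forall b w, f (tens b w) \in A) -> (limg f <= A)%VS.
Proof.
move=> fA; apply/subvP => _ /memv_imgP[t _ ->].
rewrite (tlift_unique (fun b w => erefl (f (tens b w)))).
by rewrite rpred_sum // => i _; rewrite rpred_sum // => j _; rewrite rpredZ.
Qed.

End LinearAlgebra.

(** * Cartesian powers *)

Section CartesianPower.
Variables (C : numClosedFieldType) (V : vectType C).

Fact cart_single_linear m (j : 'I_m) : linear (fun x : V => cart_single x j).
Proof.
move=> a x y; apply/ffunP => k; rewrite !ffunE.
by case: ifP; rewrite ?scaler0 ?addr0.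
Qed.

Lemma cart_single_sum m (j : 'I_m) I (s : seq I) (x : I -> V) :
  cart_single (\sum_(k <- s) x k) j = \sum_(k <- s) cart_single (x k) j.
Proof.
rewrite -(linfun_linearE (cart_single_linear j)) linear_sum.
by apply: eq_bigr => k _; rewrite /= (linfun_linearE (cart_single_linear j)).
Qed.

Lemma cart_singleZ m (j : 'I_m) a (x : V) :
  cart_single (a *: x) j = a *: cart_single x j.
Proof. by rewrite -!(linfun_linearE (cart_single_linear j)) linearZ. Qed.

Lemma cart_single0 m (j : 'I_m) : cart_single (0 : V) j = 0.
Proof. by apply/ffunP => k; rewrite !ffunE if_same. Qed.

Lemma cart_single_decomp m (v : cartpow m V) :
  v = \sum_j cart_single (v j) j.
Proof.
apply/ffunP => k; rewrite sum_ffunE (bigD1 k) //= ffunE eqxx.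
by rewrite big1 ?addr0 // => j /negPf jk; rewrite ffunE eq_sym jk.
Qed.

(** Along an injective h this is extension by zero outside the image of h. *)
Definition cart_ext d m (h : 'I_d -> 'I_m) : 'Hom(cartpow d V, cartpow m V) :=
  linfun (fun v : cartpow d V => \sum_k cart_single (v k) (h k)).

Fact cart_ext_linear d m (h : 'I_d -> 'I_m) :
  linear (fun v : cartpow d V => \sum_k cart_single (v k) (h k)).
Proof.
move=> a v w; rewrite scaler_sumr -big_split; apply: eq_bigr => k _ /=.
by rewrite !ffunE cart_single_linear.
Qed.

Lemma cart_extE d m (h : 'I_d -> 'I_m) (v : cartpow d V) :
  cart_ext h v = \sum_k cart_single (v k) (h k).
Proof. exact: linfun_linearE (cart_ext_linear h) v. Qed.

Lemma cart_map_ext d m (h : 'I_d -> 'I_m) (T : 'End(V)) (v : cartpow d V) :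
  cart_map m T (cart_ext h v) = cart_ext h (cart_map d T v).
Proof.
rewrite !cart_extE linear_sum; apply: eq_bigr => k _.
apply/ffunP => j; rewrite !(ffunE, cart_mapE).
by case: ifP; rewrite ?linear0.
Qed.

Definition cart_restr m (A : {set 'I_m}) : 'End(cartpow m V) :=
  linfun (fun v : cartpow m V =>
            [ffun k => if k \in A then v k else 0] : cartpow m V).

Lemma cart_restrE m (A : {set 'I_m}) v k :
  cart_restr A v k = if k \in A then v k else 0.
Proof.
rewrite /cart_restr linfun_linearE ?ffunE // => a w w'.
by apply/ffunP => l; rewrite !ffunE; case: ifP; rewrite ?scaler0 ?addr0.
Qed.

(** The image is the Cartesian power of the image of T, parametrized
injectively by the families of elements of that image. *)
Lemma rank_cart_map d (T : 'End(V)) :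
  lfun_rank (cart_map d T) = (d * lfun_rank T)%N.
Proof.
pose L := limg T; pose W : vectType C := {ffun 'I_d -> subvs_of L}.
pose g (w : W) : cartpow d V := [ffun k => vsval (w k)].
have lin_g : linear g by move=> a v w; apply/ffunP => k; rewrite !ffunE linearP.
have gE := linfun_linearE lin_g.
have -> : lfun_rank (cart_map d T) = \dim (limg (linfun g)).
  congr (\dim _); apply/eqP; rewrite eqEsubv; apply/andP; split.
    apply/subvP => _ /memv_imgP[v _ ->].
    have -> : cart_map d T v = linfun g [ffun k => vsproj L (T (v k))].
      apply/ffunP => k.
      by rewrite gE cart_mapE !ffunE vsprojK // memv_img ?memvf.
    by rewrite memv_img ?memvf.
  apply/subvP => _ /memv_imgP[w _ ->].
  have -> : linfun g w = cart_map d T [ffun k => (T^-1)%VF (vsval (w k))].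
    by apply/ffunP => k; rewrite gE cart_mapE !ffunE limg_lfunVK ?subvsP.
  by rewrite memv_img ?memvf.
rewrite limg_dim_eq; first by rewrite dimvf /dim /= card_ord.
apply/eqP; rewrite -subv0; apply/subvP => w; rewrite memv_cap memvf memv_ker gE.
move/eqP/ffunP => gw0; rewrite memv0; apply/eqP/ffunP => k.
by apply: val_inj; have:= gw0 k; rewrite !ffunE.
Qed.

End CartesianPower.

(** * The symmetrizer on tensors supported at one position *)

Section Symmetrizer.
Variables (C : numClosedFieldType) (m : nat) (G : {group 'S_m}).
Variables (U V : vectType C) (dot : {dot U for conjC}) (X : 'S_m -> 'End(U)).
Hypothesis uX : unitary_rep G dot X.

Local Notation P := (@symmetrizer C m G U V X).

Lemma symmetrizer_commute (Q : 'End(cartpow m V)) :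
    {in G, forall s v, Q (cart_perm V s v) = cart_perm V s (Q v)} ->
  forall b v, tmap \1 Q (P (tens b v)) = P (tens b (Q v)).
Proof.
move=> QG b v; rewrite !symmetrizerE linearZ linear_sum.
congr (_ *: _); apply: eq_bigr => s sG.
by rewrite /= !tmap_tens id_lfunE QG.
Qed.

Lemma symmetrizer_cart_map (T : 'End(V)) b v :
  tmap \1 (cart_map m T) (P (tens b v)) = P (tens b (cart_map m T v)).
Proof.
by rewrite -comp_lfunE symmetrizer_comm comp_lfunE tmap_tens id_lfunE.
Qed.

(** The summand of index t on the left is the summand of index s * t on the
right. *)
Lemma symmetrizer_act s b v : s \in G ->
  P (tens (X s b) (cart_perm V s v)) = P (tens b v).
Proof.
case: uX => _ XM _ sG; rewrite !symmetrizerE; congr (_ *: _).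
rewrite [RHS](reindex_inj (mulgI s)).
apply: eq_big => [t | t tG]; first by rewrite groupMl.
by rewrite !tmap_tens XM // cart_permM !comp_lfunE.
Qed.

Lemma symmetrizer_single_act s b (x : V) j : s \in G ->
  P (tens b (cart_single x (s j))) = P (tens (X s^-1%g b) (cart_single x j)).
Proof.
move=> sG; rewrite -[RHS](symmetrizer_act _ _ sG) cart_perm_single.
case: uX => X1 XM _.
by rewrite -comp_lfunE -XM ?groupV // mulVg X1 id_lfunE.
Qed.

(** An element of the stabilizer of j fixes the vectors supported at j, so by
[symmetrizer_act] it can be applied to the first factor alone. *)
Lemma symmetrizer_single_mean b (x : V) j :
  P (tens (stab_mean G X j b) (cart_single x j)) =
  P (tens b (cart_single x j)).
Proof.
rewrite [stab_mean G X j b]scale_lfunE sum_lfunE tenslZ tensl_sum linearZ linear_sum.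
rewrite (eq_bigr (fun=> P (tens b (cart_single x j)))) => [|s].
  rewrite sumr_const -scaler_nat /= scalerA mulVf ?scale1r //.
  by rewrite pnatr_eq0 -lt0n cardG_gt0.
case/setIP=> sG /astab1P /= sj.
by rewrite -[RHS](symmetrizer_act _ _ sG) cart_perm_single -[s j]/(aperm j s) sj.
Qed.

Lemma mem_orbital_subspace r (u : r.-tuple U) b (x : V) j :
  basis_of fullv u -> P (tens b (cart_single x j)) \in orbital_subspace G X u x j.
Proof.
move=> bu; rewrite (coord_basis bu (memvf b)) tensl_sum linear_sum /=.
rewrite rpred_sum // => k _; rewrite tenslZ linearZ rpredZ // memv_span //.
by rewrite -tnth_nth; apply: map_f; rewrite mem_enum.
Qed.

End Symmetrizer.

(** * The symmetry class as a Cartesian power of V *)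

Section Isomorphism.
Variables (C : numClosedFieldType) (m : nat) (G : {group 'S_m}).
Variables (U V : vectType C) (dot : {dot U for conjC}) (X : 'S_m -> 'End(U)).
Variables (r n : nat) (u : r.-tuple U) (e : n.-tuple V) (A : {set 'I_m}).
Hypotheses (uX : unitary_rep G dot X) (bu : basis_of fullv u).
Hypotheses (be : basis_of fullv e) (dA : is_Dhat G X u e A).

Local Notation P := (@symmetrizer C m G U V X).

(** Restricting to one orbit and projecting on one basis line of V both commute
with the symmetrizer, and reduce the claim to the linear independence that A is
chosen for. *)
Lemma symmetrizer_Dhat_inj (w : cartpow m V) :
  (forall j, j \notin A -> w j = 0) -> P (tens u`_0 w) = 0 -> w = 0.
Proof.
case: dA => D [J [/and3P[_ _ /forall_inP trD] bJ defA]] w0 Pw0.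
apply/ffunP => k; rewrite [RHS]ffunE.
have [|/w0 //] := boolP (k \in A); rewrite defA.
case/bigcupP=> j jD kJ; have [sJ /= bas] := bJ j jD.
rewrite (coord_basis be (memvf (w k))) big1 // => i _.
(* f is the projection on the line of e_i along the other basis vectors. *)
pose f (x : V) := coord e i x *: tnth e i.
have lin_f : linear f by move=> a x y; rewrite /f linearP scalerDl scalerA.
have fE := linfun_linearE lin_f.
have restrG : {in G, forall s v, cart_restr V (orbit 'P G j) (cart_perm V s v)
    = cart_perm V s (cart_restr V (orbit 'P G j) v)}.
  move=> s sG v; apply/ffunP => l.
  rewrite !(cart_restrE, cart_permE) -[(s^-1)%g l]/('P%act l s^-1%g).
  by rewrite orbit_actr ?groupV.
suff ->: coord e i (w k) = 0 by rewrite scale0r.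
apply: (@free_map_sum_eq0 _ _ _ _ (fun l => coord e i (w l))
  (enum (J j)) (basis_free (bas i))); last by rewrite mem_enum.
have := congr1 (tmap \1 (cart_restr V (orbit 'P G j))) Pw0.
rewrite linear0 (symmetrizer_commute _ restrG).
move/(congr1 (tmap \1 (cart_map m (linfun f)))).
rewrite linear0 symmetrizer_cart_map => Qw0; rewrite -[RHS]Qw0 {Qw0}.
rewrite [cart_map _ _ _ in RHS]cart_single_decomp tensr_sum linear_sum /=.
rewrite big_enum /= big_mkcond /=.
apply: eq_bigr => l _.
rewrite cart_mapE fE /f cart_restrE.
case: ifP => [lJ | lJ].
  by rewrite (subsetP sJ) // cart_singleZ tensrZ linearZ.
case: ifP => [lj | _]; last first.
  by rewrite linear0 scale0r cart_single0 tensr0 linear0.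
(* Within the orbit of j, the set A is just J j: a further element would come
   from a second representative of this orbit. *)
rewrite w0 ?linear0; last first.
  rewrite defA; apply/bigcupP=> -[j' j'D lJ']; have [sJ' _] := bJ j' j'D.
  have lj' := subsetP sJ' l lJ'.
  have jj' : orbit 'P G j = orbit 'P G j'.
    by rewrite -(orbit_eqP lj) -(orbit_eqP lj').
  have /cards1P[z Dz] := trD _ (imset_f (orbit 'P G) (in_setT j)).
  have: j \in [set z] by rewrite -Dz inE orbit_refl; case/setIP: jD => ->.
  have: j' \in [set z].
    by rewrite -Dz inE jj' orbit_refl; case/setIP: j'D => ->.
  by rewrite !inE => /eqP zj' /eqP zj; rewrite zj -zj' lJ' in lJ.
by rewrite !scale0r cart_single0 tensr0 linear0.
Qed.

(** Every generator P (b (x) e_ij) is moved to the representative of the orbit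
of j; there it is zero when the representative is outside Omega, and otherwise
in the orbital subspace that the chosen vectors span. *)
Lemma symmetry_class_Dhat_sub (W : {vspace tensor U (cartpow m V)}) :
    (forall x k, k \in A -> P (tens u`_0 (cart_single x k)) \in W) ->
  (symmetry_class G V X <= W)%VS.
Proof.
case: dA => D [J [/and3P[_ _ /forall_inP trD] bJ defA]] AW.
apply: limg_tens_sub => b w.
rewrite [w]cart_single_decomp tensr_sum linear_sum rpred_sum // => j _ /=.
rewrite (coord_basis be (memvf (w j))) cart_single_sum tensr_sum linear_sum.
rewrite rpred_sum // => i _ /=.
rewrite cart_singleZ tensrZ linearZ rpredZ //= -tnth_nth.
have /cards1P[k Dk] := trD _ (imset_f (orbit 'P G) (in_setT j)).
have /setIP[kD]: k \in D :&: orbit 'P G j by rewrite Dk inE.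
rewrite orbit_sym => /orbitP[s sG /= <-].
rewrite -[aperm k s]/(s k) (symmetrizer_single_act uX) //.
have [kO | kO] := boolP (k \in Omega G X); last first.
  rewrite -(symmetrizer_single_mean uX).
  move: kO; rewrite inE negbK => /eqP->.
  by rewrite zero_lfunE tensl0 linear0 mem0v.
have kDO : k \in D :&: Omega G X by rewrite inE kD.
have [_ bas] := bJ k kDO.
apply: (subvP _ _ (mem_orbital_subspace _ _ _ _ _ bu)).
rewrite -(span_basis (bas i)); apply/span_subvP => _ /mapP[l lJ ->].
apply: AW; rewrite defA; apply/bigcupP; exists k => //.
by rewrite mem_enum in lJ.
Qed.

(** Phi below identifies the symmetry class with a Cartesian power of V, on which
the induced operator becomes the Cartesian power of T. *)
Lemma rank_induced_op (T : 'End(V)) :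
  lfun_rank (induced_op G X T) = (lfun_rank T * #|A|)%N.
Proof.
pose h : 'I_#|A| -> 'I_m := enum_val.
pose Phi : 'Hom(cartpow #|A| V, tensor U (cartpow m V)) :=
  (P \o linfun (tens u`_0) \o cart_ext V h)%VF.
have PhiE v : Phi v = P (tens u`_0 (cart_ext V h v)).
  by rewrite !comp_lfunE (linfun_linearE (tens_linearr _)).
have extE v k : cart_ext V h v (h k) = v k.
  rewrite cart_extE sum_ffunE (bigD1 k) //= ffunE eqxx.
  rewrite big1 ?addr0 // => l lk.
  by rewrite ffunE (inj_eq enum_val_inj) eq_sym (negPf lk).
have ker0 : lker Phi == 0%VS.
  rewrite -subv0; apply/subvP => v; rewrite memv_ker memv0 PhiE => /eqP Pv0.
  apply/eqP/ffunP => k; rewrite -extE (symmetrizer_Dhat_inj _ Pv0) ?ffunE //.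
  move=> j jA; rewrite cart_extE sum_ffunE big1 // => l _; rewrite ffunE.
  by case: eqP => // jl; rewrite jl enum_valP in jA.
have img : limg Phi = symmetry_class G V X.
  apply/eqP; rewrite eqEsubv; apply/andP; split.
    by apply/subvP => _ /memv_imgP[v _ ->]; rewrite PhiE memv_img ?memvf.
  apply: symmetry_class_Dhat_sub => x k kA.
  have -> : P (tens u`_0 (cart_single x k)) =
      Phi (cart_single x (enum_rank_in kA k)).
    rewrite PhiE; congr (P (tens _ _)).
    rewrite cart_extE (bigD1 (enum_rank_in kA k)) //= ffunE eqxx.
    rewrite /h enum_rankK_in // big1 ?addr0 // => l lk.
    rewrite ffunE (negPf lk).
    by rewrite cart_single0.
  by rewrite memv_img ?memvf.
have intertwine v : tmap \1 (cart_map m T) (Phi v) = Phi (cart_map #|A| T v).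
  by rewrite !PhiE symmetrizer_cart_map cart_map_ext.
have -> : lfun_rank (induced_op G X T) =
    \dim (Phi @: limg (cart_map #|A| T)).
  (* The induced operator acts on a subtype; its image is compared with the
     image of the operator on the ambient space through the inclusion. *)
  pose inc : 'Hom(subvs_of (symmetry_class G V X), _) := linfun vsval.
  have incE x : inc x = vsval x by rewrite lfunE.
  rewrite /lfun_rank -(@limg_dim_eq _ _ _ inc); last first.
    have /eqP-> : lker inc == 0%VS.
      by apply/lker0P => x y; rewrite !incE => /val_inj.
    by rewrite capv0.
  congr (\dim _); rewrite -!limg_comp.
  have -> : (Phi \o cart_map #|A| T = tmap \1 (cart_map m T) \o Phi)%VF.
    by apply/lfunP => v; rewrite [LHS]comp_lfunE [RHS]comp_lfunE intertwine.
  rewrite [in RHS]limg_comp img.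
  apply/eqP; rewrite eqEsubv; apply/andP; split.
    apply/subvP => _ /memv_imgP[x _ ->].
    by rewrite comp_lfunE incE val_induced_op memv_img ?subvsP.
  apply/subvP => _ /memv_imgP[y yS ->].
  have -> : tmap \1 (cart_map m T) y =
      (inc \o induced_op G X T)%VF (vsproj (symmetry_class G V X) y).
    by rewrite comp_lfunE incE val_induced_op vsprojK.
  by rewrite memv_img ?memvf.
rewrite limg_dim_eq; last by rewrite (eqP ker0) capv0.
by rewrite -/(lfun_rank _) rank_cart_map mulnC.
Qed.

End Isomorphism.

Theorem theorem3p4 (R : realType) (m : nat) (G : {group 'S_m})
    (U V : vectType R[i])
    (dotU : {dot U for conjC}) (dotV : {dot V for conjC})
    (X : 'S_m -> 'End(U)) (T : 'End(V))
    (r n : nat) (u : r.-tuple U) (e : n.-tuple V) (Dhat : {set 'I_m}) :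
  unitary_rep G dotU X ->
  irreducible_rep G X ->
  orthonormal_basis dotU u ->
  orthonormal_basis dotV e ->
  is_Dhat G X u e Dhat ->
  lfun_rank (induced_op G X T) = (lfun_rank T * #|Dhat|)%N.
Proof.
move=> uX _ /andP[bu _] /andP[be _] dA.
exact: rank_induced_op uX bu be dA T.
Qed.
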